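(* Let $G=(V,E)$ be a semantic graph in which each contextual keyword centroid $v\in V$ is an $L_2$-normalized vector on $\mathbb{S}^{d-1}$, with $V$ sufficiently dense in $\mathbb{S}^{d-1}$ in the sense given in the context. Define a dense boilerplate clique as a spherical cap $C(c,\epsilon)=\{v\in\mathbb{S}^{d-1}:\arccos(S(v,c))\le\epsilon\}$ with angular radius $\epsilon\in(0,\pi/2)$ around a centre $c$. (i) (Insufficiency of the lower bound.) If the edge admissibility condition only requires $S(v_i,v_{i+1})\ge\tau_{\min}$, then for any clique satisfying $\cos(2\epsilon)\ge\tau_{\min}$, every pair $(u,v)\in C(c,\epsilon)\times C(c,\epsilon)$ satisfies the condition, permitting paths of arbitrary length to remain within $C(c,\epsilon)$. (ii) (Sufficiency of the upper bound.) Under the additional constraint $S(v_i,v_{i+1})\le\tau_{\max}$, if $\epsilon<\tfrac12\arccos(\tau_{\max})$, then for any $v_i\in C(c,\epsilon)$, the admissibility condition eliminates every $u\in C(c,\epsilon)$ as a candidate for the next node, forcing $v_{i+1}\notin C(c,\epsilon)$ and guaranteeing escape from the dense clique.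
   Context: $\mathbb{S}^{d-1}$ is the unit sphere of $\mathbb{R}^d$ ($d\ge 2$), and $S(u,v)$ denotes cosine similarity, which for unit vectors is the inner product $\langle u,v\rangle$. $G=(V,E)$ is a directed graph whose nodes are contextual keyword centroids: each is the $L_2$-normalized embedding vector of a text consisting of a keyword together with representative question-answer pairs in which it appears. Paths $(v_1,v_2,\dots)$ are sequences of nodes of $V$ built by successive extension: from the current node $v_i$ a search selects a next node $v_{i+1}$ such that the pair $(v_i,v_{i+1})$ satisfies the stated edge admissibility condition. $\tau_{\min}$ and $\tau_{\max}$ are the lower and upper similarity thresholds for consecutive nodes. Standing density assumption: $V$ is sufficiently dense in $\mathbb{S}^{d-1}$ so that, for the constraint parameters $(\tau_{\min},\tau_{\max})$ used in the path search (which are $(0.70,0.90)$), a valid successor always exists at each path extension step and no search branch terminates prematurely. *)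

(* Defs.v *)
From mathcomp Require Import all_boot all_order all_algebra.
From mathcomp Require Import all_classical all_reals all_analysis.

Set Implicit Arguments.
Unset Strict Implicit.
Unset Printing Implicit Defensive.

Import Order.TTheory GRing.Theory Num.Theory.

Local Open Scope classical_set_scope.
Local Open Scope ring_scope.

Definition dot (R : realType) (d : nat) (u v : 'rV[R]_d) : R :=
  \sum_(i < d) u 0 i * v 0 i.

(* The library norm `|u| on row vectors is the max-norm, hence this one. *)
Definition norm2 (R : realType) (d : nat) (u : 'rV[R]_d) : R :=
  Num.sqrt (dot u u).

Definition cos_sim (R : realType) (d : nat) (u v : 'rV[R]_d) : R :=
  dot u v / (norm2 u * norm2 v).

Definition sphere2 (R : realType) (d : nat) : set 'rV[R]_d :=
  [set v | norm2 v = 1].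

Definition cap (R : realType) (d : nat) (c : 'rV[R]_d) (eps : R) :
    set 'rV[R]_d :=
  [set v | sphere2 v /\ acos (cos_sim v c) <= eps].

Record semantic_graph (R : realType) (d : nat) := SemanticGraph {
  node : set 'rV[R]_d;
  edge : rel 'rV[R]_d;
  node_sphere : node `<=` @sphere2 R d;
  edge_node : forall u v, edge u v -> node u /\ node v }.

Definition adm_lower (R : realType) (d : nat) (tmin : R) : rel 'rV[R]_d :=
  fun u v => tmin <= cos_sim u v.

Definition adm_band (R : realType) (d : nat) (tmin tmax : R) : rel 'rV[R]_d :=
  fun u v => tmin <= cos_sim u v <= tmax.

Definition edges_given_by (R : realType) (d : nat) (G : semantic_graph R d)
    (adm : rel 'rV[R]_d) : Prop :=
  forall u v, node G u -> node G v -> edge G u v = adm u v.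

(* "Sufficiently dense" is relative to the thresholds: from every node the
   search finds an admissible successor, so that no branch stops early. *)
Definition sufficiently_dense (R : realType) (d : nat)
    (G : semantic_graph R d) (tmin tmax : R) : Prop :=
  forall v, node G v -> exists2 u, node G u & adm_band tmin tmax v u.

(* Nodes may be revisited along a path. *)
Definition is_path (R : realType) (d : nat) (G : semantic_graph R d)
    (s : seq 'rV[R]_d) : Prop :=
  (forall v, v \in s -> node G v) /\ sorted (edge G) s.

(* Main.v *)
(** If [u], [v] are unit vectors within angle [eps <= pi / 2] of the unit vector
    [c], then [<u + v, c> >= 2 cos eps >= 0], and Cauchy-Schwarz against [c]
    gives [4 (cos eps)^2 <= |u + v|^2 = 2 + 2 <u, v>], that is,
    [<u, v> >= cos (2 eps)]. Both parts compare this bound with a threshold. *)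

Require Import Defs.
From mathcomp Require Import all_boot all_order all_algebra.
From mathcomp Require Import all_classical all_reals all_analysis.
From mathcomp Require Import lra.

Set Implicit Arguments.
Unset Strict Implicit.
Unset Printing Implicit Defensive.

Import Order.TTheory GRing.Theory Num.Theory.

Local Open Scope classical_set_scope.
Local Open Scope ring_scope.

Section DotProduct.
Variables (R : realType) (d : nat).
Implicit Types (u v w c : 'rV[R]_d).

Lemma dotC u v : dot u v = dot v u.
Proof. by apply: eq_bigr => i _; rewrite mulrC. Qed.

Lemma dotDl u v w : dot (u + v) w = dot u w + dot v w.
Proof. by rewrite -big_split; apply: eq_bigr => i _; rewrite mxE mulrDl. Qed.

Lemma dotZl a u v : dot (a *: u) v = a * dot u v.
Proof. by rewrite mulr_sumr; apply: eq_bigr => i _; rewrite mxE mulrA. Qed.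

Lemma dot_ge0 u : 0 <= dot u u.
Proof. by apply: sumr_ge0 => i _; rewrite -expr2 sqr_ge0. Qed.

Lemma dot_sphere u : sphere2 u -> dot u u = 1.
Proof.
by move=> u1; rewrite -[LHS]sqr_sqrtr ?dot_ge0// [Num.sqrt _]u1 expr1n.
Qed.

Lemma cos_sim_sphere u v : sphere2 u -> sphere2 v -> cos_sim u v = dot u v.
Proof. by move=> u1 v1; rewrite /cos_sim u1 v1 mulr1 divr1. Qed.

(** Cauchy-Schwarz against a unit vector: the residual of [w] after projection onto [c] has squared
    length [dot w w - dot w c ^+ 2], which is nonnegative. *)
Lemma sqr_dot_le w c : sphere2 c -> dot w c ^+ 2 <= dot w w.
Proof.
move=> /dot_sphere c1; have := dot_ge0 (w + (- dot w c) *: c).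
rewrite dotDl dotZl !(dotC _ (w + _)) !dotDl !dotZl c1 (dotC c w).
by lra.
Qed.

Lemma cap_dot_ge c eps u : sphere2 c -> 0 <= eps <= pi -> cap c eps u ->
  cos eps <= dot u c.
Proof.
move=> c1 /andP[e0 epi] [u1]; rewrite cos_sim_sphere//.
(* [acosK] inverts [acos] only on [-1, 1]; Cauchy-Schwarz puts [dot u c] there. The rest is that
   [cos] decreases on [0, pi]. *)
have uc1 : -1 <= dot u c <= 1.
  rewrite -ler_norml -(@expr_le1 _ 2)// real_normK ?num_real//.
  by rewrite -(dot_sphere u1) sqr_dot_le.
move=> le_eps; rewrite -[leRHS]acosK//.
by rewrite leNgt ltr_cos ?in_itv/= ?acos_ge0 ?acos_lepi ?e0 ?epi// -leNgt.
Qed.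

Lemma cap_cos_sim_ge c eps u v : sphere2 c -> 0 <= eps <= pi / 2 ->
  cap c eps u -> cap c eps v -> cos (2 * eps) <= cos_sim u v.
Proof.
move=> c1 /andP[e0 epi2] uC vC; have [[u1 _] [v1 _]] := (uC, vC).
have epi : 0 <= eps <= pi by rewrite e0; have := pi_ge0 R; lra.
(* The sign allows squaring [2 * cos eps <= dot (u + v) c]; this is where [eps <= pi / 2] enters. *)
have k0 : 0 <= cos eps by rewrite cos_ge0_pihalf// epi2; lra.
have uc := cap_dot_ge c1 epi uC; have vc := cap_dot_ge c1 epi vC.
have := sqr_dot_le (u + v) c1.
rewrite cos_sim_sphere// mulr_natl cos_mulr2n !dotDl !(dotC _ (u + v)) !dotDl.
rewrite (dotC v u) (dot_sphere u1) (dot_sphere v1).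
nra.
Qed.

End DotProduct.

(** One extension step of the search. Read forwards it extracts the last edge, for the escape claim;
    read backwards it appends an admissible successor. *)
Lemma is_path_rcons (R : realType) (d : nat) (G : semantic_graph R d)
    (s : seq 'rV[R]_d) (v u : 'rV[R]_d) :
  is_path G (rcons (rcons s v) u) <->
  [/\ is_path G (rcons s v), node G u & edge G v u].
Proof.
have sortedE : sorted (edge G) (rcons (rcons s v) u) =
    sorted (edge G) (rcons s v) && edge G v u.
  by case: s => [|x s] /=; rewrite ?andbT// rcons_path last_rcons.
rewrite /is_path sortedE; split.
  move=> [nodes /andP[-> ->]]; split=> //; last first.
    by apply: nodes; rewrite mem_rcons mem_head.
  by split=> // w ws; apply: nodes; rewrite mem_rcons inE ws orbT.
move=> [[nodes ->] Gu ->]; split=> // w.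
by rewrite mem_rcons inE => /predU1P[->|/nodes].
Qed.

Theorem theorem2 (R : realType) (d : nat) (hd : (2 <= d)%N)
    (G : semantic_graph R d) (tmin tmax : R)
    (hdense : sufficiently_dense G tmin tmax)
    (c : 'rV[R]_d) (hc : sphere2 c)
    (eps : R) (heps : 0 < eps < pi / 2) :
  (edges_given_by G (adm_lower tmin) ->
   tmin <= cos (2 * eps) ->
   [/\ (forall u v, cap c eps u -> cap c eps v -> adm_lower tmin u v),
       (forall s : seq 'rV[R]_d,
          (forall v, v \in s -> node G v /\ cap c eps v) -> is_path G s)
     & (forall v, node G v -> cap c eps v ->
        forall n : nat, exists s : seq 'rV[R]_d,
          [/\ size s = n, is_path G (v :: s)
            & forall u, u \in s -> cap c eps u])])
  /\
  (edges_given_by G (adm_band tmin tmax) ->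
   -1 <= tmax <= 1 ->
   eps < acos tmax / 2 ->
   [/\ (forall v u, cap c eps v -> cap c eps u -> ~~ adm_band tmin tmax v u),
       (forall (s : seq 'rV[R]_d) v u,
          is_path G (rcons (rcons s v) u) -> cap c eps v -> ~ cap c eps u)
     & (forall (s : seq 'rV[R]_d) v,
          is_path G (rcons s v) -> cap c eps v ->
          exists2 u, is_path G (rcons (rcons s v) u) & ~ cap c eps u)]).
Proof.
have /andP[e0 epi2] := heps.
have simC u v : cap c eps u -> cap c eps v -> cos (2 * eps) <= cos_sim u v.
  by apply: cap_cos_sim_ge => //; rewrite !ltW.
split=> [GE tmin_le | GE tmax1 eps_lt].
  have admC u v : cap c eps u -> cap c eps v -> adm_lower tmin u v.
    by move=> uC vC; exact: le_trans tmin_le (simC _ _ uC vC).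
  have pathC (s : seq 'rV[R]_d) :
      (forall v, v \in s -> node G v /\ cap c eps v) -> is_path G s.
    move=> sC; split=> [v /sC[]//|].
    (* Any two nodes of the cap are joined by an edge, so all pairs of entries are related, not just
       consecutive ones, and no induction on [s] is needed. *)
    apply: (@pairwise_sorted _ (edge G)); apply/(pairwiseP 0) => i j si sj _.
    have [[Gi Ci] [Gj Cj]] := (sC _ (mem_nth 0 si), sC _ (mem_nth 0 sj)).
    by rewrite GE// admC.
  (* The cap may contain no node other than [v], but [v] is admissible with itself, so the walk that
     stays at [v] has any desired length. *)
  split=> // v Gv vC n; exists (nseq n v); split; first exact: size_nseq.
    by apply: pathC => u; rewrite (mem_nseq n.+1) => /eqP->.
  by move=> u; rewrite mem_nseq => /andP[_ /eqP->].
(* Apply the decreasing [cos] to [2 * eps < acos tmax], both sides lying in [0, pi]. *)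
have tmax_lt : tmax < cos (2 * eps).
  rewrite -[ltLHS]acosK// ltr_cos; first lra.
    by rewrite in_itv/=; lra.
  by rewrite in_itv/= acos_ge0 ?acos_lepi.
have nadmC v u : cap c eps v -> cap c eps u -> ~~ adm_band tmin tmax v u.
  move=> vC uC; rewrite negb_and -!ltNge.
  by rewrite (lt_le_trans tmax_lt (simC _ _ vC uC)) orbT.
split=> // [s v u /is_path_rcons[[nodes _] Gu vu] vC uC | s v sv vC].
  have Gv : node G v by apply: nodes; rewrite mem_rcons mem_head.
  by move: vu; rewrite GE//; apply/negP/nadmC.
have Gv : node G v by apply: sv.1; rewrite mem_rcons mem_head.
(* Density supplies an admissible successor, so escape really happens; [nadmC] places it outside the
   cap. *)
have [u Gu vu] := hdense v Gv; exists u; last first.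
  by move=> uC; move: vu; apply/negP/nadmC.
by apply/is_path_rcons; rewrite GE.
Qed.
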